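(* Let $d\ge1$, $\nu>0$, $\mu>0$, and let $N$ be a random variable with $\Pr\{N=n\}=c_n^{(\nu,\mu)}$, $n=0,1,\dots$. Then $\sum_{n=0}^\infty c_n^{(\nu,\mu)}=1$; if $\nu,\mu>1$ then \[ EN=\frac d2\left(\frac{B(\nu-1,\mu-1)}{B(\nu,\mu)}-1\right); \] and if $\nu,\mu>2$ then \[ \operatorname{Var}(N)=\frac d4\left((d+2)\frac{B(\nu-2,\mu-2)}{B(\nu,\mu)}-2\frac{B(\nu-1,\mu-1)}{B(\nu,\mu)}-d\frac{B^2(\nu-1,\mu-1)}{B^2(\nu,\mu)}\right). \]
   Context: $c_n^{(\nu,\mu)}=\frac{1}{B(\nu,\mu)}\frac{(\frac d2)_n}{n!}\int_0^1 t^{\mu+\frac d2-1}(1-t)^{\nu+\frac d2-1}(1-t+t^2)^n\,dt$, where $B$ is the Beta function and $(a)_n=a(a+1)\cdots(a+n-1)$. *)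

(* Defs.v *)
From HB Require Import structures.
From mathcomp Require Import all_boot all_order all_algebra.
From mathcomp Require Import all_classical all_reals all_analysis.
Set Implicit Arguments. Unset Strict Implicit. Unset Printing Implicit Defensive.
Import Order.TTheory GRing.Theory Num.Theory.
Import numFieldNormedType.Exports.
Local Open Scope classical_set_scope.
Local Open Scope ring_scope.

Definition Beta {R : realType} (a b : R) : R :=
  Rintegral (@lebesgue_measure R) `]0%R, 1%R[
    (fun t : R => powR t (a - 1) * powR (1 - t) (b - 1)).

Definition poch {R : realType} (a : R) (n : nat) : R :=
  \prod_(i < n) (a + i%:R).

Definition coef {R : realType} (d : nat) (nu mu : R) (n : nat) : R :=
  (Beta nu mu)^-1 * (poch (d%:R / 2) n / (n`!)%:R) *
  Rintegral (@lebesgue_measure R) `]0%R, 1%R[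
    (fun t : R => powR t (mu + d%:R / 2 - 1) * powR (1 - t) (nu + d%:R / 2 - 1)
                  * (1 - t + t ^+ 2) ^+ n).

(* Main.v *)
Require Import Defs.
From HB Require Import structures.
From mathcomp Require Import all_boot all_order all_algebra.
From mathcomp Require Import all_classical all_reals all_analysis.
From mathcomp Require Import measurable_realfun ring lra.
Import Order.TTheory GRing.Theory Num.Theory.
Import numFieldNormedType.Exports.
Local Open Scope classical_set_scope.
Local Open Scope ring_scope.

(* Put [a = d/2]. Since [1 - (1 - t + t^2) = t (1 - t)], the binomial series
   [sum_n n(n-1)...(n-j+1) (a)_n/n! z^n = (a)_j z^j (1 - z)^(-a-j)] at
   [z = 1 - t + t^2] cancels the powers [t^a (1 - t)^a] of the integrand, so that
   by monotone convergence the [j]-th factorial moment of [N] is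
   [(a)_j / B(nu, mu)] times the integral of
   [t^(mu-j-1) (1 - t)^(nu-j-1) (1 - t (1 - t))^j], a combination of Beta values.
   The moments [j = 0, 1, 2] give the total mass, the mean and the variance. *)

(** * Rising factorials and the coefficients of the binomial series *)

Lemma poch_recr (R : realType) (a : R) n : poch a n.+1 = poch a n * (a + n%:R).
Proof. by rewrite /poch big_ord_recr. Qed.

Lemma poch_ge0 (R : realType) (a : R) n : 0 <= a -> 0 <= poch a n.
Proof. by move=> a0; apply: prodr_ge0 => i _; rewrite addr_ge0. Qed.

Lemma poch_add (R : realType) (a : R) m n :
  poch a (m + n) = poch a m * poch (a + m%:R) n.
Proof.
rewrite /poch big_split_ord/=; congr (_ * _); apply: eq_bigr => i _.
by rewrite natrD addrA.
Qed.

(** The coefficient of z^n in the power series of (1 - z)^(-a). *)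
Definition binom_coef {R : realType} (a : R) n := poch a n / (n`!)%:R.

Lemma binom_coef_ge0 (R : realType) (a : R) n : 0 <= a -> 0 <= binom_coef a n.
Proof. by move=> a0; rewrite divr_ge0// poch_ge0. Qed.

(** Coefficient form of (1 - z) s' = a s, the differential equation solved by (1 - z)^(-a). *)
Lemma binom_coefS (R : realType) (a : R) n :
  n.+1%:R * binom_coef a n.+1 = (a + n%:R) * binom_coef a n.
Proof.
rewrite /binom_coef poch_recr factS natrM.
have n0 : (n.+1%:R : R) != 0 by rewrite pnatr_eq0.
have m0 : ((n`!)%:R : R) != 0 by rewrite pnatr_eq0 -lt0n fact_gt0.
by field; rewrite m0 nat1r n0.
Qed.

(** * The binomial series and its factorial-weighted versions *)

Lemma cvg0_ratio (R : realType) (u : R^nat) (q : R) M :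
  0 <= q < 1 -> (forall n, 0 <= u n) ->
  (forall n, (M <= n)%N -> u n.+1 <= q * u n) -> u n @[n --> \oo] --> 0.
Proof.
move=> /andP[q0 q1] u0 uq; rewrite -(cvg_shiftn M)/=.
have ub k : u (k + M)%N <= u M * q ^+ k.
  elim: k => [|k IH]; first by rewrite expr0 mulr1.
  rewrite addSn (le_trans (uq _ _)) ?leq_addl//.
  by rewrite exprS mulrCA ler_wpM2l.
apply: (@squeeze_cvgr _ _ _ _ (cst 0) (geometric (u M) q)).
- by apply: nearW => k; rewrite u0 ub.
- exact: cvg_cst.
- by apply: cvg_geometric; rewrite ger0_norm.
Qed.

(** By [binom_coefS] the ratio of consecutive terms is (a + n) z / n, which tends to z < 1. The
    factor n is there because the remainder in [binom_partial_ode] carries it. *)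
Lemma binom_coef_cvg0 (R : realType) (a z : R) : 0 <= a -> 0 <= z < 1 ->
  n%:R * binom_coef a n * z ^+ n @[n --> \oo] --> 0.
Proof.
move=> a0 /andP[z0 z1]; pose q := (1 + z) / 2.
have zq : 0 < q - z by rewrite /q; lra.
(* With [q] the midpoint of z and 1, the inequality (a + n) z <= q n amounts to n >= a z / (q -
   z). *)
pose M := (Num.truncn (a * z / (q - z))).+1.
apply: (@cvg0_ratio _ _ q M) => [|n|n Mn].
- by rewrite /q; lra.
- apply: mulr_ge0; last exact: exprn_ge0.
  by apply: mulr_ge0 => //; exact: binom_coef_ge0.
- rewrite binom_coefS exprS.
  have -> : (a + n%:R) * binom_coef a n * (z * z ^+ n) =
    ((a + n%:R) * z) * (binom_coef a n * z ^+ n) by ring.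
  have -> : q * (n%:R * binom_coef a n * z ^+ n) =
    (q * n%:R) * (binom_coef a n * z ^+ n) by ring.
  apply: ler_wpM2r.
    by apply: mulr_ge0; [exact: binom_coef_ge0|exact: exprn_ge0].
  have : a * z / (q - z) < n%:R.
    by apply: lt_le_trans (truncnS_gt _) _; rewrite ler_nat.
  by rewrite ltr_pdivrMr// => h; lra.
Qed.

Lemma is_derive_binom_partial (R : realType) (a x : R) N :
  is_derive x 1 (fun y => \sum_(k < N) binom_coef a k * y ^+ k)
    (\sum_(k < N) binom_coef a k * (k%:R * x ^+ k.-1)).
Proof.
have -> : (fun y => \sum_(k < N) binom_coef a k * y ^+ k) =
  \sum_(k < N) (fun y => binom_coef a k * y ^+ k).
  by apply/funext => y; rewrite fct_sumE.
apply: is_derive_sum => k.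
have -> : (fun y => binom_coef a k * y ^+ k) =
    binom_coef a k \*: ((@id R : R -> R) ^+ k).
  by apply/funext => y; rewrite !fctE.
by apply: is_derive_eq; rewrite scaler1.
Qed.

(* With [s_N] the partial sum, [(1 - x) s_N' - a s_N] telescopes to a single term. *)
Lemma binom_partial_ode (R : realType) (a x : R) N :
  (1 - x) * (\sum_(k < N.+1) binom_coef a k * (k%:R * x ^+ k.-1))
    - a * (\sum_(k < N.+1) binom_coef a k * x ^+ k)
  = - (N.+1%:R * binom_coef a N.+1 * x ^+ N).
Proof.
elim: N => [|N IH].
  by rewrite !big_ord_recl !big_ord0/= binom_coefS !expr0; ring.
rewrite big_ord_recr/= [X in _ - a * X]big_ord_recr/=.
rewrite !mulrDr opprD addrACA IH binom_coefS.
have -> : N.+2%:R * binom_coef a N.+2 = (a + N.+1%:R) * binom_coef a N.+1.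
  exact: binom_coefS.
by rewrite -binom_coefS exprS; ring.
Qed.

Lemma powRS1 (R : realType) (a y : R) : 0 < y -> y `^ a = y `^ (a - 1) * y.
Proof.
move=> y0; rewrite -[X in _ * X](powRr1 (ltW y0)) -powRD ?subrK//.
by rewrite (gt_eqF y0) implybT.
Qed.

(** The function g(y) = s(y) (1 - y)^a has g(0) = 1, and by [binom_partial_ode] its derivative is
    the single term -(1 - y)^(a-1) (N+1) c_(N+1) y^N, where c_k is [binom_coef a k]. The mean value
    theorem on [0, z] turns this into a bound on g(z) - 1. *)
Lemma binom_partial_bound (R : realType) (a z : R) N : 0 <= a -> 0 <= z < 1 ->
  `|(\sum_(k < N.+1) binom_coef a k * z ^+ k) * (1 - z) `^ a - 1| <=
  (1 - z)^-1 * (N.+1%:R * binom_coef a N.+1 * z ^+ N.+1).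
Proof.
move=> a0 /andP[z0 z1].
pose s (y : R) := \sum_(k < N.+1) binom_coef a k * y ^+ k.
pose ds (y : R) := \sum_(k < N.+1) binom_coef a k * (k%:R * y ^+ k.-1).
have dg (y : R) : y < 1 -> is_derive y 1 (fun y => s y * (1 - y) `^ a)
    (- (1 - y) `^ (a - 1) * (N.+1%:R * binom_coef a N.+1 * y ^+ N)).
  move=> y1.
  have d1 : is_derive y 1 (fun y : R => (1 - y) `^ a)
      (a * (1 - y) `^ (a - 1) * (0 - 1)).
    apply: (@is_derive1_comp R (fun y => y `^ a) (fun y => 1 - y)).
    by apply: is_derive1_powR; rewrite subr_gt0.
  apply: (is_derive_eq (@is_deriveM R R s (fun y => (1 - y) `^ a) y 1 _ _
    (is_derive_binom_partial _ _ _ _) d1)).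
  rewrite /GRing.scale/= mulNr -mulrN -binom_partial_ode -/(s y) -/(ds y).
  by rewrite (@powRS1 _ a) ?subr_gt0//; ring.
have dg0 (y : R) : y \in `]0, z[%R -> y < 1.
  by rewrite in_itv/= => /andP[_ yz]; exact: lt_trans yz z1.
have [|c] := MVT_segment z0 (fun y yz => dg y (dg0 y yz)).
  apply: derivable_within_continuous => y; rewrite in_itv/= => /andP[_ yz].
  by apply: ex_derive; apply: dg; exact: le_lt_trans z1.
rewrite in_itv/= => /andP[c0 cz].
have -> : s 0 * (1 - 0) `^ a = 1.
  rewrite subr0 powR1 mulr1 /s big_ord_recl expr0 mulr1 big1 ?addr0.
    by rewrite /binom_coef /poch big_ord0 fact0 divr1.
  by move=> i _; rewrite expr0n/= mulr0.
move=> ->; have c1 : 0 < 1 - c by rewrite subr_gt0 (le_lt_trans cz).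
have b0 : 0 <= N.+1%:R * binom_coef a N.+1.
  by apply: mulr_ge0 => //; exact: binom_coef_ge0.
rewrite subr0 !mulNr normrN ger0_norm; last first.
  by rewrite mulr_ge0// mulr_ge0 ?powR_ge0// mulr_ge0// exprn_ge0.
rewrite -mulrA ler_pM ?powR_ge0//.
- by rewrite mulr_ge0// mulr_ge0// exprn_ge0.
(* The exponent a - 1 may have either sign, so the bound goes through (1 - z) (1 - c)^(a-1) <= (1 -
   c)^a <= 1, which uses only c <= z and a >= 0. *)
- rewrite -(@ler_pM2l _ (1 - z)) ?subr_gt0// divff ?subr_eq0 ?gt_eqF//.
  apply: (@le_trans _ _ ((1 - c) `^ a)).
    rewrite (@powRS1 R a _ c1) // mulrC.
    by apply: ler_wpM2l; rewrite ?powR_ge0 ?lerB.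
  apply: (@le_trans _ _ (1 `^ a)); last by rewrite powR1.
  by apply: ge0_ler_powR; rewrite ?nnegrE ?gerBl// ltW.
- by rewrite exprSr mulrA ler_wpM2r// ler_wpM2l// lerXn2r.
Qed.

Lemma binom_series (R : realType) (a z : R) : 0 <= a -> 0 <= z < 1 ->
  series (fun n => binom_coef a n * z ^+ n) n @[n --> \oo] --> (1 - z) `^ (- a).
Proof.
move=> a0 z01; have [z0 z1] := andP z01.
(* The remainder bound concerns sums of N + 1 terms, whereas [series] at n has n terms. *)
rewrite -(cvg_shiftn 1).
have cg : (\sum_(k < n.+1) binom_coef a k * z ^+ k) * (1 - z) `^ a
    @[n --> \oo] --> (1 : R).
  apply/subr_cvg0.
  apply: norm_cvg0.
  apply: (@squeeze_cvgr _ _ _ _ (cst 0)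
    (fun N => (1 - z)^-1 * (N.+1%:R * binom_coef a N.+1 * z ^+ N.+1))).
  - by apply: nearW => N; rewrite normr_ge0 binom_partial_bound.
  - exact: cvg_cst.
  - rewrite -[X in _ --> X](mulr0 (1 - z)^-1); apply: cvgMr.
    by have := @binom_coef_cvg0 R a z a0 z01; rewrite -cvg_shiftS.
have z1' : (1 - z) `^ a != 0 by rewrite gt_eqF// powR_gt0// subr_gt0.
rewrite powRN -[((1 - z) `^ a)^-1]mul1r.
have -> : [sequence series (fun n => binom_coef a n * z ^+ n) (n + 1)%N]_n =
    (fun n => (\sum_(k < n.+1) binom_coef a k * z ^+ k) * (1 - z) `^ a
       * ((1 - z) `^ a)^-1).
  by apply/funext => n; rewrite mulfK//= addn1 seriesEord.
by apply: cvgMl.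
Qed.

(** Coefficient form of differentiating (1 - z)^(-a) j times: the falling factorial shifts the index
    by j and the parameter to a + j. Factorial moments thus reduce to the plain binomial series,
    with no termwise differentiation. *)
Lemma ffact_binom_coef (R : realType) (a : R) j m :
  ((m + j) ^_ j)%:R * binom_coef a (m + j) = poch a j * binom_coef (a + j%:R) m.
Proof.
rewrite /binom_coef addnC poch_add.
have := ffact_fact (leq_addr m j); rewrite addKn => <-; rewrite natrM.
have n0 : ((m`!)%:R : R) != 0 by rewrite pnatr_eq0 -lt0n fact_gt0.
have k0 : (((j + m) ^_ j)%:R : R) != 0.
  by rewrite pnatr_eq0 -lt0n ffact_gt0 leq_addr.
by field; rewrite n0 k0.
Qed.

Lemma ffact_binom_series (R : realType) (a z : R) j : 0 <= a -> 0 <= z < 1 ->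
  series (fun n => (n ^_ j)%:R * (binom_coef a n * z ^+ n)) n @[n --> \oo] -->
    poch a j * z ^+ j * (1 - z) `^ (- (a + j%:R)).
Proof.
(* The first j terms vanish with the falling factorial, so the sum is reindexed from j. *)
move=> a0 z01; rewrite -(cvg_shiftn j).
have -> : [sequence series (fun n => (n ^_ j)%:R * (binom_coef a n * z ^+ n))
      (n + j)%N]_n =
    (fun n => poch a j * z ^+ j
       * series (fun n => binom_coef (a + j%:R) n * z ^+ n) n).
  apply/funext => n; rewrite /= /series/=.
  rewrite (big_cat_nat (n := j))//= ?leq_addl// [X in X + _]big_nat big1 ?add0r;
    last first.
    by move=> i /andP[_ ij]; rewrite ffact_small// mul0r.
  rewrite -{1}(add0n j) big_addn addnK mulr_sumr; apply: eq_bigr => i _.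
  rewrite mulrA ffact_binom_coef exprD; ring.
by apply: cvgMr; apply: binom_series => //; rewrite addr_ge0.
Qed.

(** * Termwise integration of series with nonnegative terms *)

Lemma series_Rintegral {d : measure_display} {T : measurableType d} {R : realType}
    (m : {measure set T -> \bar R}) (D : set T) (f : (T -> R)^nat) (F : T -> R) :
  measurable D -> (forall n, measurable_fun D (f n)) ->
  (forall n x, D x -> 0 <= f n x) -> m.-integrable D (EFin \o F) ->
  (forall x, D x -> series (f^~ x) n @[n --> \oo] --> F x) ->
  series (fun n => Rintegral m D (f n)) n @[n --> \oo] --> Rintegral m D F.
Proof.
move=> mD mf f0 iF sF.
(* Each nonnegative term is at most the whole sum, so it inherits integrability from [F]. *)
have fF n x : D x -> f n x <= F x.
  move=> Dx; have nd : nondecreasing_seq (series (f^~ x)).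
    by apply/nondecreasing_series => i _ _; exact: f0.
  have := nondecreasing_cvgn_le nd (cvgP _ (sF x Dx)) n.+1.
  rewrite (cvg_lim _ (sF x Dx))// => /(le_trans _); apply.
  rewrite seriesEnat/= big_nat_recr//= lerDr sumr_ge0// => i _; exact: f0.
have ifn n : m.-integrable D (EFin \o f n).
  apply: le_integrable iF => //; first exact/measurable_EFinP.
  move=> x Dx /=; rewrite lee_fin !ger0_norm ?f0 ?fF//.
  exact: le_trans (f0 n x Dx) (fF n x Dx).
have IE n : (\int[m]_(x in D) (f n x)%:E)%E = (Rintegral m D (f n))%:E.
  by rewrite /Rintegral fineK//; exact: (integrable_fin_num mD (ifn n)).
(* Monotone convergence is applied in the extended reals; finiteness of all the integrals brings the
   result back to real numbers. *)
have key : (\sum_(n <oo) (Rintegral m D (f n))%:E)%E = (Rintegral m D F)%:E.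
  under eq_eseriesr do rewrite -IE.
  rewrite -integral_nneseries//; last by move=> n; exact/measurable_EFinP.
  rewrite [RHS]fineK; last exact: (integrable_fin_num mD iF).
  apply: eq_integral => x; rewrite inE => Dx.
  apply/cvg_lim => //.
  under eq_fun do rewrite sumEFin.
  by apply: cvg_EFin; [exact: nearW|exact: sF].
have : (\sum_(0 <= k < n) (Rintegral m D (f k))%:E)%E @[n --> \oo] -->
    (Rintegral m D F)%:E.
  rewrite -key; apply: is_cvg_nneseries => n _ _.
  by rewrite lee_fin Rintegral_ge0// => x; exact: f0.
by under eq_fun do rewrite sumEFin; move/fine_cvg.
Qed.

(** * Exhaustion of ]0, 1[ by compact intervals *)

Definition margin {R : realType} n : R := n.+3%:R^-1.

Lemma margin_gt0 (R : realType) n : 0 < margin n :> R.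
Proof. by rewrite invr_gt0. Qed.

(** The offset 3 in [margin] makes even the interval of index 0 nondegenerate, as the fundamental
    theorem of calculus requires. *)
Lemma margin_lt (R : realType) n : margin n < 1 - margin n :> R.
Proof.
have : margin n <= 3^-1 :> R by rewrite lef_pV2 ?posrE// ler_nat.
lra.
Qed.

Lemma itv01_margin (R : realType) :
  `]0, 1[%classic = \bigcup_n `[margin n, 1 - margin n]%classic :> set R.
Proof.
apply/seteqP; split => x /=; rewrite ?in_itv/=; last first.
  move=> [n _]; rewrite /= in_itv/= => /andP[nx xn].
  have := margin_gt0 R n; lra.
move=> /andP[x0 x1].
pose e := Num.min x (1 - x).
have e0 : 0 < e by rewrite lt_min x0 subr_gt0.
exists (Num.truncn e^-1) => //=.
have me : margin (Num.truncn e^-1) <= e.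
  rewrite -[leRHS]invrK lef_pV2 ?posrE ?invr_gt0//.
  by rewrite (le_trans (ltW (truncnS_gt _)))// ler_nat -addn2 leq_addr.
move: me; rewrite le_min in_itv/= => /andP[-> ?]/=; lra.
Qed.

(** Reduces integrals of functions possibly unbounded at 0 and 1 to compact intervals, where the
    calculus theorems for continuous functions apply. *)
Lemma cvg_integral_margin (R : realType) (f : R -> R) :
  measurable_fun (`]0, 1[%classic : set R) f -> (forall x, x \in `]0, 1[%R -> 0 <= f x) ->
  (\int[lebesgue_measure]_(x in `[margin n, (1 - margin n)%R]) (f x)%:E)%E
    @[n --> \oo] --> (\int[lebesgue_measure]_(x in `]0%R, 1%R[) (f x)%:E)%E.
Proof.
move=> mf f0; rewrite itv01_margin.
apply: ge0_nondecreasing_set_cvg_integral => //.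
- move=> n p np; apply/subsetPset => x /=; rewrite !in_itv/= => /andP[nx xn].
  have : margin p <= margin n :> R by rewrite lef_pV2 ?posrE// ler_nat.
  lra.
- move=> n; apply/measurable_EFinP; apply: measurable_funS mf => //.
  by move=> x nx; rewrite itv01_margin; exists n.
- move=> n x nx; have : (`]0, 1[%classic : set R) x.
    by rewrite itv01_margin; exists n.
  by rewrite /= lee_fin => /f0.
Qed.

(** * Integrability, symmetry and positivity of the Beta integral *)

Lemma powR_le1 (R : realType) (a y : R) :
  0 < a -> 0 < y -> y <= 1 -> y `^ a <= 1.
Proof.
move=> a0 y0 y1; apply: (@le_trans _ _ (1 `^ a)); last by rewrite powR1.
by apply: ge0_ler_powR => //; rewrite ?nnegrE ltW.
Qed.

Definition beta_kernel {R : realType} (p q t : R) : R :=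
  t `^ (p - 1) * (1 - t) `^ (q - 1).

Lemma beta_kernel_ge0 (R : realType) (p q t : R) : 0 <= beta_kernel p q t.
Proof. by rewrite mulr_ge0 ?powR_ge0. Qed.

Lemma measurable_beta_kernel (R : realType) (p q : R) (D : set R) :
  measurable_fun D (beta_kernel p q).
Proof.
apply: measurable_funTS; apply: measurable_funM; first exact: measurable_powR.
apply: (@measurableT_comp _ _ _ _ _ _ (fun t => t `^ (q - 1))).
  exact: measurable_powR.
by apply: measurable_funB.
Qed.

Lemma is_derive_powR_onem (R : realType) (q t : R) : 0 < 1 - t ->
  is_derive t 1 (fun t : R => (1 - t) `^ q) (- (q * (1 - t) `^ (q - 1))).
Proof.
move=> t1.
have d : is_derive t 1 (fun t : R => (1 - t) `^ q)
    (q * (1 - t) `^ (q - 1) * (0 - 1)).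
  apply: (@is_derive1_comp R (fun y => y `^ q) (fun y => 1 - y)).
  exact: is_derive1_powR.
by apply: is_derive_eq; rewrite sub0r mulrN1.
Qed.

Lemma continuous_beta_kernel (R : realType) (p q t : R) : 0 < t < 1 ->
  {for t, continuous (beta_kernel p q)}.
Proof.
move=> /andP[t0 t1]; apply: continuousM.
  apply/differentiable_continuous/derivable1_diffP/ex_derive.
  exact: is_derive1_powR.
apply/differentiable_continuous/derivable1_diffP/ex_derive.
by apply: is_derive_powR_onem; rewrite subr_gt0.
Qed.

(** The kernel is dominated by t^(p-1) + (1 - t)^(q-1), which has an explicit primitive and total
    integral 1/p + 1/q over ]0, 1[. The bound does not depend on n, hence it survives the limit. *)
Lemma integral_beta_kernel_margin_le (R : realType) (p q : R) n :
  0 < p -> 0 < q ->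
  (\int[lebesgue_measure]_(x in `[margin n, (1 - margin n)%R])
     (beta_kernel p q x)%:E <= (p^-1 + q^-1)%:E)%E.
Proof.
move=> p0 q0.
have m0 := margin_gt0 R n; have m1 := margin_lt R n.
pose g (t : R) := t `^ (p - 1) + (1 - t) `^ (q - 1).
pose G (t : R) := p^-1 * t `^ p - q^-1 * (1 - t) `^ q.
have inm (t : R) : t \in `[margin n, (1 - margin n)%R] -> 0 < t /\ 0 < 1 - t.
  by rewrite in_itv/= => /andP[? ?]; split; lra.
have cg : {within `[margin n, (1 - margin n)%R]%classic, continuous g}.
  apply: derivable_within_continuous => t /inm[t0 t1].
  apply: ex_derive; apply: is_deriveD.
    exact: is_derive1_powR.
  exact: is_derive_powR_onem.
have dG (t : R) : 0 < t -> 0 < 1 - t -> is_derive t 1 G (g t).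
  move=> t0 t1.
  have := @is_deriveB R R R _ _ t 1 _ _
     (is_deriveZ p^-1 (@is_derive1_powR R p t t0))
     (is_deriveZ q^-1 (@is_derive_powR_onem R q t t1)).
  move=> d; apply: is_derive_eq.
  by rewrite /GRing.scale/= /g mulrN opprK !mulrA !mulVf ?gt_eqF// !mul1r.
have FTC : (\int[lebesgue_measure]_(x in `[margin n, (1 - margin n)%R])
    (g x)%:E = (G (1 - margin n)%R)%:E - (G (margin n))%:E)%E.
  apply: continuous_FTC2 => //.
  - split => [t tm||].
    + have [t0 t1] := inm _ (subset_itv_oo_cc tm).
      exact: (@ex_derive _ _ _ _ _ _ _ (dG t t0 t1)).
    + apply: cvg_at_right_filter.
      apply/differentiable_continuous/derivable1_diffP/ex_derive.
      by apply: dG; lra.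
    + apply: cvg_at_left_filter.
      apply/differentiable_continuous/derivable1_diffP/ex_derive.
      by apply: dG; lra.
  - move=> t tm; have [t0 t1] := inm _ (subset_itv_oo_cc tm).
    by rewrite derive1E (@derive_val _ _ _ _ _ _ _ (dG t t0 t1)).
apply: (@le_trans _ _ (\int[lebesgue_measure]_(x in `[margin n, (1 - margin n)%R])
    (g x)%:E)%E).
  apply: ge0_le_integral => //.
  - by move=> t _; rewrite lee_fin beta_kernel_ge0.
  - by apply/measurable_EFinP; exact: measurable_beta_kernel.
  - apply/measurable_EFinP; apply: subspace_continuous_measurable_fun => //.
  - move=> t /= /inm[t0 t1]; rewrite lee_fin.
    (* multiply the kernel by [1 = t + (1 - t)] *)
    have -> : beta_kernel p q t =
        t `^ p * (1 - t) `^ (q - 1) + t `^ (p - 1) * (1 - t) `^ q.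
      by rewrite /beta_kernel (powRS1 _ p _ t0) (powRS1 _ q _ t1); ring.
    rewrite /g addrC lerD//.
      by rewrite ler_piMr ?powR_ge0// powR_le1//; lra.
    by rewrite ler_piMl ?powR_ge0// powR_le1//; lra.
rewrite FTC -EFinB lee_fin /G subKr.
(* In [G (1 - margin n) - G (margin n)] the two powers of [margin n] enter negatively and are
   dropped; the other two terms are at most 1/p and 1/q. *)
have : 0 <= q^-1 * margin n `^ q by rewrite mulr_ge0 ?powR_ge0 ?invr_ge0 ?ltW.
have : 0 <= p^-1 * margin n `^ p by rewrite mulr_ge0 ?powR_ge0 ?invr_ge0 ?ltW.
have : p^-1 * (1 - margin n) `^ p <= p^-1.
  by rewrite ler_piMr ?invr_ge0 ?powR_le1 ?ltW//; lra.
have : q^-1 * (1 - margin n) `^ q <= q^-1.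
  by rewrite ler_piMr ?invr_ge0 ?powR_le1 ?ltW//; lra.
lra.
Qed.

Lemma integrable_beta_kernel (R : realType) (p q : R) : 0 < p -> 0 < q ->
  lebesgue_measure.-integrable (`]0, 1[%classic : set R)
    (EFin \o beta_kernel p q).
Proof.
move=> p0 q0; apply/integrableP; split.
  by apply/measurable_EFinP; exact: measurable_beta_kernel.
under eq_integral do rewrite /= ger0_norm ?beta_kernel_ge0//.
apply: (@le_lt_trans _ _ (p^-1 + q^-1)%:E); last exact: ltry.
have := cvg_integral_margin R _ (measurable_beta_kernel R p q _)
  (fun x _ => beta_kernel_ge0 R p q x).
move=> h; apply: (cvge_to_le h); apply: nearW => n.
exact: integral_beta_kernel_margin_le.
Qed.

Lemma beta_kernelC (R : realType) (p q t : R) :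
  beta_kernel p q (1 - t) = beta_kernel q p t.
Proof. by rewrite /beta_kernel subKr mulrC. Qed.

(* The exhaustion by compact intervals makes the substitution [t -> 1 - t]
   available although the kernel may be unbounded. *)
Lemma BetaC (R : realType) (p q : R) : Beta p q = Beta q p.
Proof.
rewrite /Beta /Rintegral -/(beta_kernel p q) -/(beta_kernel q p); congr fine.
have c (p q : R) := cvg_integral_margin R _ (measurable_beta_kernel R p q _)
  (fun x _ => beta_kernel_ge0 R p q x).
apply: (cvg_unique _ (c p q)) => //.
suff -> : (fun n => \int[lebesgue_measure]_(x in `[margin n, (1 - margin n)%R])
     (beta_kernel p q x)%:E)%E = (fun n =>
     \int[lebesgue_measure]_(x in `[margin n, (1 - margin n)%R])
     (beta_kernel q p x)%:E)%E by exact: c.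
apply/funext => n.
have m0 := margin_gt0 R n; have m1 := margin_lt R n.
have d1 (x : R) : is_derive x 1 (fun y : R => 1 - y) (-1).
  rewrite -sub0r; exact: (is_deriveB (is_derive_cst _ _ _) (is_derive_id _ _)).
have E1 : (fun y : R => 1 - y)^`()%classic = cst (-1).
  by apply/funext => x; rewrite derive1E derive_val.
have := @integration_by_substitution_decreasing R (fun y : R => 1 - y)
  (beta_kernel p q) (margin n) (1 - margin n).
(* The interval is symmetric about 1/2, so the substitution maps it onto itself. *)
rewrite E1 subKr => ->.
- apply: eq_integral => x _; congr EFin.
  by rewrite !fctE opprK mulr1 beta_kernelC.
- exact: ltW.
- by move=> x y _ _; rewrite ltrD2l ltrN2.
- by move=> x _; exact: cvg_cst.
- exact: is_cvg_cst.
- exact: is_cvg_cst.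
- split.
  + by move=> x _; exact: ex_derive.
  + by apply: cvg_at_right_filter; apply: cvgB; [exact: cvg_cst|exact: cvg_id].
  + by apply: cvg_at_left_filter; apply: cvgB; [exact: cvg_cst|exact: cvg_id].
- apply: continuous_in_subspaceT => x; rewrite inE/= in_itv/= => /andP[? ?].
  by apply: continuous_beta_kernel; lra.
Qed.

(** A zero integral would force the nonnegative kernel to vanish almost everywhere; being positive
    at every point of ]0, 1[, it would make this interval null. *)
Lemma Beta_gt0 (R : realType) (p q : R) : 0 < p -> 0 < q -> 0 < Beta p q.
Proof.
move=> p0 q0; rewrite lt_neqAle Rintegral_ge0 ?andbT; last first.
  by move=> x _; exact: beta_kernel_ge0.
apply/eqP => B0.
have i0 : (\int[lebesgue_measure]_(x in (`]0%R, 1%R[%classic : set R))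
    `|(beta_kernel p q x)%:E| = 0)%E.
  under eq_integral do rewrite /= ger0_norm ?beta_kernel_ge0//.
  rewrite -[LHS]fineK; first by congr EFin.
  exact: (integrable_fin_num _ (integrable_beta_kernel R p q p0 q0)).
have mf : measurable_fun (`]0%R, 1%R[%classic : set R)
    (EFin \o beta_kernel p q).
  by apply/measurable_EFinP; exact: measurable_beta_kernel.
have [N [mN N0 sN]] := (ae_eq_integral_abs lebesgue_measure
  (measurable_itv _) mf).1 i0.
have : (lebesgue_measure (`]0%R, 1%R[%classic : set R) <= 0)%E.
  rewrite -N0; apply: le_measure; rewrite ?inE//.
  apply: subset_trans sN => x /= x01 h0.
  have := h0 x01; rewrite /= in x01 *.
  move: x01; rewrite in_itv/= => /andP[x0 x1] [] /eqP.
  by rewrite gt_eqF// mulr_gt0// powR_gt0// subr_gt0.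
by rewrite lebesgue_measure_itv/= lte_fin ltr01 oppr0 adde0 lee_fin ler10.
Qed.

(** * Factorial moments as integrals of Beta kernels *)

Lemma beta_kernelS (R : realType) (p q t : R) : t \in `]0, 1[%R ->
  beta_kernel p q t * (1 - t + t ^+ 2) =
  beta_kernel p q t - beta_kernel (p + 1) (q + 1) t.
Proof.
rewrite in_itv/= => /andP[t0 t1].
(* Since 1 - t + t^2 = 1 - t (1 - t), the subtracted part is the kernel with both exponents raised
   by one. *)
rewrite /beta_kernel (powRS1 _ (p + 1 - 1) _ t0).
rewrite (powRS1 _ (q + 1 - 1) (1 - t)) ?subr_gt0// !addrK; ring.
Qed.

Lemma onem_quad_bound (R : realType) (t : R) : t \in `]0, 1[%R ->
  0 <= 1 - t + t ^+ 2 < 1.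
Proof. by rewrite in_itv/= => /andP[t0 t1]; apply/andP; split; nra. Qed.

Lemma measurable_onem_quad (R : realType) (n : nat) (D : set R) :
  measurable_fun D (fun t : R => (1 - t + t ^+ 2) ^+ n).
Proof.
apply: measurable_funX; apply: measurable_funD; first exact: measurable_funB.
exact: measurable_funX.
Qed.

Lemma integrable_beta_kernel_quad (R : realType) (p q : R) n : 0 < p -> 0 < q ->
  lebesgue_measure.-integrable (`]0, 1[%classic : set R)
    (EFin \o (fun t => beta_kernel p q t * (1 - t + t ^+ 2) ^+ n)).
Proof.
move=> p0 q0.
apply: le_integrable (integrable_beta_kernel R p q p0 q0) => //.
  apply/measurable_EFinP; apply: measurable_funM.
    exact: measurable_beta_kernel.
  exact: measurable_onem_quad.
move=> t /= /onem_quad_bound /andP[z0 z1]; rewrite lee_fin normrM.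
by rewrite ler_piMr// ger0_norm ?exprn_ge0// exprn_ile1// ltW.
Qed.

(** With 1 - z = t (1 - t), the power -(a + j) cancels the shift by a in both exponents and lowers
    them by j further; the dimension disappears from the integrand here. *)
Lemma beta_kernel_shift (R : realType) (p q a t : R) (j : nat) :
  t \in `]0, 1[%R ->
  (1 - (1 - t + t ^+ 2)) `^ (- (a + j%:R)) * beta_kernel (p + a) (q + a) t =
  beta_kernel (p - j%:R) (q - j%:R) t.
Proof.
rewrite in_itv/= => /andP[t0 t1]; have t1' : 0 < 1 - t by rewrite subr_gt0.
have -> : 1 - (1 - t + t ^+ 2) = t * (1 - t) by ring.
rewrite powRM ?ltW// /beta_kernel mulrACA.
rewrite -!powRD ?(gt_eqF t0) ?(gt_eqF t1') ?implybT//.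
by congr (_ `^ _ * _ `^ _); ring.
Qed.

(** Termwise integration of [ffact_binom_series] against the kernel. The conditions on j are those
    making the limit kernel integrable. In [coef] the exponent of t comes from [mu], so [mu] is the
    first parameter of the kernel. *)
Lemma ffact_moment (R : realType) (d : nat) (nu mu : R) (j : nat) :
  j%:R < nu -> j%:R < mu ->
  series (fun n => (n ^_ j)%:R * coef d nu mu n) n @[n --> \oo] -->
    (Beta nu mu)^-1 * (poch (d%:R / 2) j *
      Rintegral (@lebesgue_measure R) `]0%R, 1%R[
        (fun t => beta_kernel (mu - j%:R) (nu - j%:R) t * (1 - t + t ^+ 2) ^+ j)).
Proof.
move=> jnu jmu; set a : R := d%:R / 2.
have a0 : 0 <= a by rewrite divr_ge0.
have nu0 : 0 < nu + a by rewrite ltr_wpDr// (le_lt_trans _ jnu).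
have mu0 : 0 < mu + a by rewrite ltr_wpDr// (le_lt_trans _ jmu).
pose K (t : R) := beta_kernel (mu + a) (nu + a) t.
pose f n (t : R) := (n ^_ j)%:R * (binom_coef a n * (K t * (1 - t + t ^+ 2) ^+ n)).
have iK n := integrable_beta_kernel_quad R (mu + a) (nu + a) n mu0 nu0.
have iF := integrable_beta_kernel_quad R (mu - j%:R) (nu - j%:R) j
  ltac:(by rewrite subr_gt0) ltac:(by rewrite subr_gt0).
have coefE n : (n ^_ j)%:R * coef d nu mu n =
    (Beta nu mu)^-1 * Rintegral (@lebesgue_measure R) `]0%R, 1%R[ (f n).
  rewrite /f; under eq_Rintegral do rewrite mulrA.
  by rewrite RintegralZl// /coef -/a -/(binom_coef a n) /K /beta_kernel; ring.
have -> : series (fun n => (n ^_ j)%:R * coef d nu mu n) = (fun n =>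
    (Beta nu mu)^-1 * series (fun n =>
      Rintegral (@lebesgue_measure R) `]0%R, 1%R[ (f n)) n).
  apply/funext => n; rewrite /series/= mulr_sumr.
  by apply: eq_bigr => i _; exact: coefE.
rewrite -RintegralZl//; apply: cvgMr.
apply: series_Rintegral => //.
- move=> n; do 2 apply: measurable_funM => //.
  apply: measurable_funM; first exact: measurable_beta_kernel.
  exact: measurable_onem_quad.
- move=> n t /= /onem_quad_bound /andP[z0 _]; rewrite mulr_ge0// mulr_ge0//.
    exact: binom_coef_ge0.
  by rewrite mulr_ge0 ?exprn_ge0// beta_kernel_ge0.
- have := integrableZl _ (poch a j) iF.
  by move=> /(_ (measurable_itv _)); apply: eq_integrable => // x _ /=;
    rewrite EFinM.
- move=> t /= t01; have z01 := onem_quad_bound R t t01.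
  (* The reduced kernel is expanded back, so that [K t] becomes a common factor of the terms and the
     limit. *)
  rewrite -(beta_kernel_shift R mu nu a t j t01) -/(K t).
  have -> : series (f^~ t) = (fun n => series (fun n => (n ^_ j)%:R *
      (binom_coef a n * (1 - t + t ^+ 2) ^+ n)) n * K t).
    apply/funext => n; rewrite /series/= mulr_suml.
    by apply: eq_bigr => i _; rewrite /f; ring.
  rewrite (_ : poch a j * _ = poch a j * (1 - t + t ^+ 2) ^+ j *
    (1 - (1 - t + t ^+ 2)) `^ (- (a + j%:R)) * K t); last by ring.
  by apply: cvgMl; exact: ffact_binom_series.
Qed.

Lemma Rintegral_beta_kernel (R : realType) (p q : R) :
  Rintegral (@lebesgue_measure R) `]0%R, 1%R[ (beta_kernel p q) = Beta p q.
Proof. by []. Qed.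

Lemma Rintegral_beta_kernel_quad1 (R : realType) (p q : R) : 0 < p -> 0 < q ->
  Rintegral (@lebesgue_measure R) `]0%R, 1%R[
    (fun t => beta_kernel p q t * (1 - t + t ^+ 2)) =
  Beta p q - Beta (p + 1) (q + 1).
Proof.
move=> p0 q0; under eq_Rintegral => t; first rewrite inE => t01.
  rewrite beta_kernelS//. over.
rewrite RintegralB//; apply: integrable_beta_kernel => //; exact: addr_gt0.
Qed.

Lemma Rintegral_beta_kernel_quad2 (R : realType) (p q : R) : 0 < p -> 0 < q ->
  Rintegral (@lebesgue_measure R) `]0%R, 1%R[
    (fun t => beta_kernel p q t * (1 - t + t ^+ 2) ^+ 2) =
  Beta p q - 2 * Beta (p + 1) (q + 1) + Beta (p + 2) (q + 2).
Proof.
move=> p0 q0; under eq_Rintegral => t; first rewrite inE => t01.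
  (* One factor is absorbed by [beta_kernelS]; the other is handled by the first-power formula at
     (p, q) and at (p + 1, q + 1). *)
  rewrite expr2 mulrA beta_kernelS// mulrBl. over.
have add2 r : r + 1 + 1 = r + 2 :> R by ring.
have q1 r s : 0 < r -> 0 < s -> (@lebesgue_measure R).-integrable `]0%R, 1%R[
    (EFin \o (fun t => beta_kernel r s t * (1 - t + t ^+ 2))).
  exact: (integrable_beta_kernel_quad R r s 1).
rewrite RintegralB//; [|by apply: q1; rewrite ?addr_gt0..].
rewrite !Rintegral_beta_kernel_quad1 ?addr_gt0// !add2; ring.
Qed.

(** * From factorial moments to total mass, mean and variance *)

Lemma cvg_factorial_moments (R : realType) (c : R^nat) (m l0 l1 l2 : R) :
  series (fun n => (n ^_ 0)%:R * c n) n @[n --> \oo] --> l0 ->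
  series (fun n => (n ^_ 1)%:R * c n) n @[n --> \oo] --> l1 ->
  series (fun n => (n ^_ 2)%:R * c n) n @[n --> \oo] --> l2 ->
  series (fun n => (n%:R - m) ^+ 2 * c n) n @[n --> \oo] -->
    l2 + (1 - 2 * m) * l1 + m ^+ 2 * l0.
Proof.
move=> h0 h1 h2.
(* The identity is (n - m)^2 = n (n - 1) + (1 - 2 m) n + m^2. The case n = 0 is treated apart
   because the falling factorial involves a truncated predecessor. *)
have -> : series (fun n => (n%:R - m) ^+ 2 * c n) = (fun n =>
   series (fun n => (n ^_ 2)%:R * c n) n
   + (1 - 2 * m) * series (fun n => (n ^_ 1)%:R * c n) n
   + m ^+ 2 * series (fun n => (n ^_ 0)%:R * c n) n).
  apply/funext => n; rewrite /series/= !mulr_sumr -!big_split/=.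
  apply: eq_bigr => -[|k] _; first by rewrite ffactn0 !ffact0n/=; ring.
  by rewrite ffactn0 ffactn1 ffactSS ffactn1 natrM -natr1; ring.
by apply: cvgD; [apply: cvgD => //|]; apply: cvgMr.
Qed.

Theorem theorem8 (R : realType) (d : nat) (nu mu : R) :
  (1 <= d)%N -> 0 < nu -> 0 < mu ->
  [/\ series (coef d nu mu) n @[n --> \oo] --> (1 : R),
      (1 < nu -> 1 < mu ->
        series (fun k => k%:R * coef d nu mu k) n @[n --> \oo] -->
          d%:R / 2 * (Beta (nu - 1) (mu - 1) / Beta nu mu - 1))
    & (2 < nu -> 2 < mu ->
        series (fun k => (k%:R - d%:R / 2 * (Beta (nu - 1) (mu - 1) / Beta nu mu - 1)) ^+ 2
                          * coef d nu mu k) n @[n --> \oo] -->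
          d%:R / 4 * ((d%:R + 2) * (Beta (nu - 2) (mu - 2) / Beta nu mu)
                      - 2 * (Beta (nu - 1) (mu - 1) / Beta nu mu)
                      - d%:R * (Beta (nu - 1) (mu - 1) ^+ 2 / Beta nu mu ^+ 2)))].
Proof.
move=> _ nu0 mu0.
have B0 := Beta_gt0 R nu mu nu0 mu0; have B0n := lt0r_neq0 B0.
set a : R := d%:R / 2.
have p0 : poch a 0 = 1 by rewrite /poch big_ord0.
have p1 : poch a 1 = a by rewrite poch_recr p0 mul1r addr0.
have p2 : poch a 2 = a * (a + 1) by rewrite poch_recr p1.
have M0 : series (fun n => (n ^_ 0)%:R * coef d nu mu n) n @[n --> \oo] -->
    (1 : R).
  have := ffact_moment R d nu mu 0 nu0 mu0.
  rewrite -/a p0 mul1r !subr0.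
  under eq_Rintegral do rewrite expr0 mulr1.
  (* The integral is [Beta mu nu]; symmetry matches it with the normalizing constant. *)
  by rewrite Rintegral_beta_kernel (BetaC _ mu) mulVf.
have M1 : 1 < nu -> 1 < mu ->
    series (fun n => (n ^_ 1)%:R * coef d nu mu n) n @[n --> \oo] -->
    a * (Beta (nu - 1) (mu - 1) / Beta nu mu - 1).
  move=> nu1 mu1; have := ffact_moment R d nu mu 1 nu1 mu1.
  rewrite -/a p1 Rintegral_beta_kernel_quad1 ?subr_gt0// !subrK.
  rewrite (BetaC _ mu) (BetaC _ (mu - 1)); congr (_ --> _).
  by move: (Beta nu mu) (Beta (nu - 1) (mu - 1)) B0n => b0 b1 b00; field.
have M2 : 2 < nu -> 2 < mu ->
    series (fun n => (n ^_ 2)%:R * coef d nu mu n) n @[n --> \oo] -->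
    a * (a + 1) * (Beta (nu - 2) (mu - 2) / Beta nu mu
      - 2 * (Beta (nu - 1) (mu - 1) / Beta nu mu) + 1).
  move=> nu2 mu2; have := ffact_moment R d nu mu 2 nu2 mu2.
  rewrite -/a p2 Rintegral_beta_kernel_quad2 ?subr_gt0// !subrK.
  have e (r : R) : r - 2 + 1 = r - 1 by ring.
  rewrite !e (BetaC _ mu) (BetaC _ (mu - 1)) (BetaC _ (mu - 2)).
  congr (_ --> _).
  by move: (Beta nu mu) (Beta (nu - 1) (mu - 1)) (Beta (nu - 2) (mu - 2)) B0n
    => b0 b1 b2 b00; field.
split.
- rewrite (_ : coef d nu mu = fun n => (n ^_ 0)%:R * coef d nu mu n)//.
  by apply/funext => n; rewrite ffactn0 mul1r.
- move=> nu1 mu1.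
  rewrite (_ : (fun k => k%:R * coef d nu mu k) =
      fun n => (n ^_ 1)%:R * coef d nu mu n); first exact: M1.
  by apply/funext => n; rewrite ffactn1.
- move=> nu2 mu2.
  have nu1 : 1 < nu by lra.
  have mu1 : 1 < mu by lra.
  (* With total mass 1 and m equal to the mean, the limit is E N(N-1) + EN - (EN)^2. *)
  have := cvg_factorial_moments R _
    (a * (Beta (nu - 1) (mu - 1) / Beta nu mu - 1)) _ _ _
    M0 (M1 nu1 mu1) (M2 nu2 mu2).
  congr (_ --> _); rewrite /a {M0 M1 M2 p0 p1 p2 a B0}.
  by move: (Beta nu mu) (Beta (nu - 1) (mu - 1)) (Beta (nu - 2) (mu - 2)) B0n
    => b0 b1 b2 b00; field.
Qed.
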